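(* Let $\mathbf U=\langle\langle U,\approx\rangle,\preceq\rangle$ be a completely lattice $\mathbf L$-ordered set. The set $\mathrm{CTol}(\mathbf U)$ of all complete $\mathbf L$-tolerances on $\mathbf U$ is an $\mathbf L$-closure system in the set $U\times U$, and hence (with the restrictions of $\approx^{U\times U}$ and $S$) a completely lattice $\mathbf L$-ordered set.
   Context: $\mathbf L=\langle L,\wedge,\vee,\otimes,\to,0,1\rangle$ is a complete residuated lattice ($\langle L,\wedge,\vee,0,1\rangle$ complete lattice, $\langle L,\otimes,1\rangle$ commutative monoid, $a\otimes b\le c$ iff $a\le b\to c$). An $\mathbf L$-set in $X$ is a map $X\to L$; $L^X$ the set of them; $S(A,B)=\bigwedge_x(A(x)\to B(x))$, $A\approx^X B=S(A,B)\wedge S(B,A)$. An $\mathbf L$-equality is a binary $\mathbf L$-relation that is reflexive ($R(x,x)=1$), symmetric, transitive ($R(x,y)\otimes R(y,z)\le R(x,z)$) and with $R(x,y)=1\Rightarrow x=y$. An $\mathbf L$-ordered set is $\langle\langle U,\approx\rangle,\preceq\rangle$, $\approx$ an $\mathbf L$-equality, $\preceq$ reflexive, transitive, compatible with $\approx$ ($(u\preceq v)\otimes(u\approx u')\otimes(v\approx v')\le(u'\preceq v')$), and $(u\preceq v)\wedge(v\preceq u)\le u\approx v$. For $V\in L^U$: $\mathcal L V(v)=\bigwedge_u(V(u)\to(v\preceq u))$, $\mathcal U V(v)=\bigwedge_u(V(u)\to(u\preceq v))$; $\inf V$ is the unique $u$ with $\mathcal L V(u)=1=\mathcal U(\mathcal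 L V)(u)$, $\sup V$ the unique $u$ with $\mathcal U V(u)=1=\mathcal L(\mathcal U V)(u)$; completely lattice means these exist for all $V$. For a set $X$, $\langle\langle L^X,\approx^X\rangle,S\rangle$ is a completely lattice $\mathbf L$-ordered set with $(\inf\mathcal V)(x)=\bigwedge_{W\in L^X}(\mathcal V(W)\to W(x))$; an $\mathbf L$-closure system in $X$ is a subset $M\subseteq L^X$ with $\inf\mathcal V\in M$ for every $\mathbf L$-set $\mathcal V$ in $L^X$ vanishing outside $M$. Power relation: for $R$ on $X$, $A,B\in L^X$, $(R\circ B)(x)=\bigvee_y R(x,y)\otimes B(y)$, $(A\circ R)(y)=\bigvee_x A(x)\otimes R(x,y)$, $R^+(A,B)=S(A,R\circ B)\wedge S(B,A\circ R)$. A binary $\mathbf L$-relation $R$ on $\mathbf U$ is complete if it is compatible with $\approx$ ($R(u,v)\otimes(u\approx u')\otimes(v\approx v')\le R(u',v')$) and $R^+(V_1,V_2)\le R(\inf V_1,\inf V_2)$, $R^+(V_1,V_2)\le R(\sup V_1,\sup V_2)$ for all $V_1,V_2\in L^U$. An $\mathbf L$-tolerance is a reflexive symmetric binary $\mathbf L$-relation. *)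

(* Defs.v *)
From HB Require Import structures.
From mathcomp Require Import all_boot all_order.
From mathcomp Require Import mathcomp_extra boolp classical_sets.
Set Implicit Arguments.
Unset Strict Implicit.
Unset Printing Implicit Defensive.
Import Order.TTheory.
Local Open Scope order_scope.

Reserved Notation "a ⊗ b" (at level 40, left associativity).
Reserved Notation "a ⇒ b" (at level 55, right associativity).
Reserved Notation "⋀_ x F" (at level 60, x name, right associativity,
  format "⋀_ x  F").
Reserved Notation "⋁_ x F" (at level 60, x name, right associativity,
  format "⋁_ x  F").

(* The bounds 0 and 1 of the residuated lattice are [\bot] and [\top]; the
   degenerate case \bot = \top is allowed. *)
HB.mixin Record isCompleteResiduated d (L : Type) of Order.TBLattice d L := {
  infimums_ex : forall A : set L, (infimums A !=set0)%classic;
  supremums_ex : forall A : set L, (supremums A !=set0)%classic;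
  otimes : L -> L -> L;
  residuum : L -> L -> L;
  otimesA : associative otimes;
  otimesC : commutative otimes;
  otimes1l : left_id \top otimes;
  adjointness : forall a b c : L, (otimes a b <= c) = (a <= residuum b c)
}.

#[short(type="completeResiduatedLatticeType")]
HB.structure Definition CompleteResiduatedLattice d :=
  { L of Order.TBLattice d L & isCompleteResiduated d L }.

Notation "a ⊗ b" := (otimes a b) : order_scope.
Notation "a ⇒ b" := (residuum a b) : order_scope.

(* The default values \top and \bot make these correct for an empty index
   type; in all other cases the default is never reached. *)
Definition bigmeet d (L : completeResiduatedLatticeType d) (I : Type)
  (F : I -> L) : L := infimum \top (range F)%classic.
Definition bigjoin d (L : completeResiduatedLatticeType d) (I : Type)
  (F : I -> L) : L := supremum \bot (range F)%classic.
Notation "⋀_ x F" := (bigmeet (fun x => F)) : order_scope.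
Notation "⋁_ x F" := (bigjoin (fun x => F)) : order_scope.

Definition lset d (L : completeResiduatedLatticeType d) (X : Type) := X -> L.

Definition lrel d (L : completeResiduatedLatticeType d) (X : Type) :=
  lset L (X * X).

Definition subsethood d (L : completeResiduatedLatticeType d) (X : Type) :
    lrel L (lset L X) :=
  fun AB => ⋀_x (AB.1 x ⇒ AB.2 x).

Definition lset_eq d (L : completeResiduatedLatticeType d) (X : Type) :
    lrel L (lset L X) :=
  fun AB => subsethood (AB.1, AB.2) `&` subsethood (AB.2, AB.1).

Definition lreflexive d (L : completeResiduatedLatticeType d) (X : Type)
  (R : lrel L X) := forall x, R (x, x) = \top.

Definition lsymmetric d (L : completeResiduatedLatticeType d) (X : Type)
  (R : lrel L X) := forall x y, R (x, y) = R (y, x).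

Definition ltransitive d (L : completeResiduatedLatticeType d) (X : Type)
  (R : lrel L X) := forall x y z, R (x, y) ⊗ R (y, z) <= R (x, z).

Definition lequality d (L : completeResiduatedLatticeType d) (X : Type)
    (R : lrel L X) :=
  [/\ lreflexive R, lsymmetric R, ltransitive R
    & forall x y, R (x, y) = \top -> x = y].

Definition lcompatible d (L : completeResiduatedLatticeType d) (X : Type)
    (eqX R : lrel L X) :=
  forall u v u' v', R (u, v) ⊗ eqX (u, u') ⊗ eqX (v, v') <= R (u', v').

Definition lordered d (L : completeResiduatedLatticeType d) (U : Type)
    (eqU leU : lrel L U) :=
  [/\ lequality eqU, lreflexive leU, ltransitive leU, lcompatible eqU leU
    & forall u v, leU (u, v) `&` leU (v, u) <= eqU (u, v)].

Definition lower_cone d (L : completeResiduatedLatticeType d) (U : Type)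
    (leU : lrel L U) (V : lset L U) : lset L U :=
  fun v => ⋀_u (V u ⇒ leU (v, u)).

Definition upper_cone d (L : completeResiduatedLatticeType d) (U : Type)
    (leU : lrel L U) (V : lset L U) : lset L U :=
  fun v => ⋀_u (V u ⇒ leU (u, v)).

Definition is_linf d (L : completeResiduatedLatticeType d) (U : Type)
    (leU : lrel L U) (V : lset L U) (u : U) :=
  lower_cone leU V u = \top /\ upper_cone leU (lower_cone leU V) u = \top.

Definition is_lsup d (L : completeResiduatedLatticeType d) (U : Type)
    (leU : lrel L U) (V : lset L U) (u : U) :=
  upper_cone leU V u = \top /\ lower_cone leU (upper_cone leU V) u = \top.

Definition completely_lattice_lordered d
    (L : completeResiduatedLatticeType d) (U : Type) (eqU leU : lrel L U) :=
  [/\ lordered eqU leU,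
      forall V : lset L U, exists! u, is_linf leU V u
    & forall V : lset L U, exists! u, is_lsup leU V u].

Record clLOrderedSet d (L : completeResiduatedLatticeType d) := CLLOrderedSet {
  cl_sort :> Type;
  cl_eq : lrel L cl_sort;
  cl_le : lrel L cl_sort;
  cl_ax : completely_lattice_lordered cl_eq cl_le
}.

Lemma linf_ex d (L : completeResiduatedLatticeType d) (U : clLOrderedSet L)
  (V : lset L U) : exists! u, is_linf (@cl_le _ _ U) V u.
Proof. by case: (cl_ax U) => _ + _; apply. Qed.

Lemma lsup_ex d (L : completeResiduatedLatticeType d) (U : clLOrderedSet L)
  (V : lset L U) : exists! u, is_lsup (@cl_le _ _ U) V u.
Proof. by case: (cl_ax U) => _ _; apply. Qed.

Definition linf d (L : completeResiduatedLatticeType d) (U : clLOrderedSet L)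
  (V : lset L U) : U := sval (cid (linf_ex V)).

Definition lsup d (L : completeResiduatedLatticeType d) (U : clLOrderedSet L)
  (V : lset L U) : U := sval (cid (lsup_ex V)).

Lemma linfP d (L : completeResiduatedLatticeType d) (U : clLOrderedSet L)
  (V : lset L U) : is_linf (@cl_le _ _ U) V (linf V).
Proof. by rewrite /linf; case: cid => u /= []. Qed.

Lemma lsupP d (L : completeResiduatedLatticeType d) (U : clLOrderedSet L)
  (V : lset L U) : is_lsup (@cl_le _ _ U) V (lsup V).
Proof. by rewrite /lsup; case: cid => u /= []. Qed.

Lemma linf_unique d (L : completeResiduatedLatticeType d)
  (U : clLOrderedSet L) (V : lset L U) u :
  is_linf (@cl_le _ _ U) V u -> linf V = u.
Proof. by rewrite /linf; case: cid => v /= [_ +]; apply. Qed.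

Lemma lsup_unique d (L : completeResiduatedLatticeType d)
  (U : clLOrderedSet L) (V : lset L U) u :
  is_lsup (@cl_le _ _ U) V u -> lsup V = u.
Proof. by rewrite /lsup; case: cid => v /= [_ +]; apply. Qed.

Lemma bigmeet_lb d (L : completeResiduatedLatticeType d) (I : Type)
  (F : I -> L) i : bigmeet F <= F i.
Proof.
have Fi : (range F (F i))%classic by exists i.
rewrite /bigmeet /infimum; case: ifPn => [/eqP F0|_]; first by rewrite F0 in Fi.
case: xgetP => [m _ [lm _]|no]; first exact: lm.
by have [m /no] := infimums_ex (range F)%classic.
Qed.

Lemma bigmeet_glb d (L : completeResiduatedLatticeType d) (I : Type)
  (F : I -> L) a : (forall i, a <= F i) -> a <= bigmeet F.
Proof.
move=> aF; rewrite /bigmeet /infimum; case: ifPn => _; first exact: lex1.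
case: xgetP => [m _ [_ gm]|no]; first by apply: gm => _ [i _ <-].
by have [m /no] := infimums_ex (range F)%classic.
Qed.

Lemma bigjoin_ub d (L : completeResiduatedLatticeType d) (I : Type)
  (F : I -> L) i : F i <= bigjoin F.
Proof.
have Fi : (range F (F i))%classic by exists i.
rewrite /bigjoin /supremum; case: ifPn => [/eqP F0|_]; first by rewrite F0 in Fi.
case: xgetP => [m _ [um _]|no]; first exact: um.
by have [m /no] := supremums_ex (range F)%classic.
Qed.

Lemma bigjoin_lub d (L : completeResiduatedLatticeType d) (I : Type)
  (F : I -> L) a : (forall i, F i <= a) -> bigjoin F <= a.
Proof.
move=> Fa; rewrite /bigjoin /supremum; case: ifPn => _; first exact: le0x.
case: xgetP => [m _ [_ gm]|no]; first by apply: gm => _ [i _ <-].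
by have [m /no] := supremums_ex (range F)%classic.
Qed.

Lemma bigmeet_top d (L : completeResiduatedLatticeType d) (I : Type)
  (F : I -> L) : bigmeet F = \top <-> forall i, F i = \top.
Proof.
split=> [F1 i|F1]; apply/eqP; rewrite -le1x.
  by rewrite -F1; exact: bigmeet_lb.
by apply: bigmeet_glb => i; rewrite F1.
Qed.

Lemma res_top d (L : completeResiduatedLatticeType d) (a b : L) :
  (a ⇒ b) = \top <-> a <= b.
Proof.
rewrite -[X in X <= _]otimes1l adjointness; rewrite le1x.
by split=> [->|/eqP].
Qed.

Lemma otimes_le2 d (L : completeResiduatedLatticeType d) (a b a' b' : L) :
  a <= a' -> b <= b' -> a ⊗ b <= a' ⊗ b'.
Proof.
move=> aa' bb'; rewrite adjointness (le_trans aa')// -adjointness.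
by rewrite otimesC adjointness (le_trans bb')// -adjointness otimesC.
Qed.

Lemma otimes_resl d (L : completeResiduatedLatticeType d) (a b : L) :
  (a ⇒ b) ⊗ a <= b.
Proof. by rewrite adjointness. Qed.

Lemma le_subsethood d (L : completeResiduatedLatticeType d) (X : Type)
  (c : L) (A B : lset L X) :
  (forall x, c ⊗ A x <= B x) <-> c <= subsethood (A, B).
Proof.
split=> [cAB|cAB x]; first by apply: bigmeet_glb => x; rewrite -adjointness.
rewrite adjointness (le_trans cAB)//.
exact: (bigmeet_lb (fun x => A x ⇒ B x)).
Qed.

Lemma subsethood_le d (L : completeResiduatedLatticeType d) (X : Type)
  (c : L) (A B : lset L X) x : c <= subsethood (A, B) -> c ⊗ A x <= B x.
Proof. by move=> /le_subsethood. Qed.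

Lemma subsethood_top d (L : completeResiduatedLatticeType d) (X : Type)
  (A B : lset L X) :
  subsethood (A, B) = \top <-> forall x, A x <= B x.
Proof.
split=> [/bigmeet_top AB x|AB]; first exact/res_top.
by apply/bigmeet_top => x; apply/res_top.
Qed.

Lemma subsethood_trans d (L : completeResiduatedLatticeType d) (X : Type) :
  ltransitive (@subsethood _ L X).
Proof.
move=> A B C; apply/le_subsethood => x.
rewrite [_ (A, B) ⊗ _]otimesC -otimesA.
have AB : subsethood (A, B) ⊗ A x <= B x by exact: subsethood_le.
apply: le_trans (otimes_le2 (lexx _) AB) _.
exact: subsethood_le.
Qed.

Lemma lset_lordered d (L : completeResiduatedLatticeType d) (X : Type) :
  lordered (@lset_eq _ L X) (@subsethood _ L X).
Proof.
have Srefl : lreflexive (@subsethood _ L X) by move=> A; apply/subsethood_top.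
have Strans := @subsethood_trans _ L X.
split=> //.
- split.
  + by move=> A; rewrite /lset_eq /= Srefl meetxx.
  + by move=> A B; rewrite /lset_eq /= meetC.
  + move=> A B C; rewrite /lset_eq /= lexI; apply/andP; split.
      by apply: le_trans (Strans A B C); apply: otimes_le2; rewrite leIl.
    rewrite otimesC; apply: le_trans (Strans C B A).
    by apply: otimes_le2; rewrite leIr.
  + move=> A B /eqP; rewrite -le1x lexI !le1x => /andP[/eqP AB /eqP BA].
    apply/funext => x; apply/le_anti/andP.
    by split; [exact: (subsethood_top A B).1|exact: (subsethood_top B A).1].
- move=> A B A' B'; apply: le_trans (Strans A' B B').
  apply: otimes_le2; last by rewrite /lset_eq leIl.
  rewrite otimesC; apply: le_trans (Strans A' A B).
  by apply: otimes_le2; rewrite ?leIr.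
Qed.

Lemma lset_is_linf d (L : completeResiduatedLatticeType d) (X : Type)
  (VV : lset L (lset L X)) :
  is_linf (@subsethood _ L X) VV (fun x => ⋀_W (VV W ⇒ W x)).
Proof.
split; apply/bigmeet_top => A; apply/res_top.
  apply/le_subsethood => x; rewrite otimesC adjointness.
  exact: (bigmeet_lb (fun W => VV W ⇒ W x)).
apply/le_subsethood => x; apply: bigmeet_glb => W.
rewrite -adjointness -otimesA [A x ⊗ _]otimesC otimesA.
apply: (subsethood_le x); rewrite adjointness.
exact: (bigmeet_lb (fun W => VV W ⇒ subsethood (A, W))).
Qed.

Lemma lset_is_lsup d (L : completeResiduatedLatticeType d) (X : Type)
  (VV : lset L (lset L X)) :
  is_lsup (@subsethood _ L X) VV (fun x => ⋁_W (VV W ⊗ W x)).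
Proof.
split; apply/bigmeet_top => A; apply/res_top.
  apply/le_subsethood => x.
  exact: (bigjoin_ub (fun W => VV W ⊗ W x)).
apply/le_subsethood => x; rewrite otimesC adjointness.
apply: bigjoin_lub => W; rewrite -adjointness otimesC otimesA.
apply: (subsethood_le x); rewrite adjointness.
exact: (bigmeet_lb (fun W => VV W ⇒ subsethood (W, A))).
Qed.

Lemma is_linf_unique d (L : completeResiduatedLatticeType d) (U : Type)
  (eqU leU : lrel L U) (V : lset L U) u v : lordered eqU leU ->
  is_linf leU V u -> is_linf leU V v -> u = v.
Proof.
case=> [[_ _ _ sep]] _ _ _ anti [lu uu] [lv uv]; apply: sep.
apply/eqP; rewrite -le1x; apply: le_trans (anti u v).
move/bigmeet_top : uu => /(_ v)/res_top; rewrite lv => uu.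
move/bigmeet_top : uv => /(_ u)/res_top; rewrite lu => uv.
by rewrite lexI uu uv.
Qed.

Lemma is_lsup_unique d (L : completeResiduatedLatticeType d) (U : Type)
  (eqU leU : lrel L U) (V : lset L U) u v : lordered eqU leU ->
  is_lsup leU V u -> is_lsup leU V v -> u = v.
Proof.
case=> [[_ _ _ sep]] _ _ _ anti [lu uu] [lv uv]; apply: sep.
apply/eqP; rewrite -le1x; apply: le_trans (anti u v).
move/bigmeet_top : uu => /(_ v)/res_top; rewrite lv => uu.
move/bigmeet_top : uv => /(_ u)/res_top; rewrite lu => uv.
by rewrite lexI uu uv.
Qed.

Lemma lset_completely_lattice d (L : completeResiduatedLatticeType d)
  (X : Type) :
  completely_lattice_lordered (@lset_eq _ L X) (@subsethood _ L X).
Proof.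
have ord := @lset_lordered _ L X; split=> // VV.
- exists (fun x => ⋀_W (VV W ⇒ W x)); split; first exact: lset_is_linf.
  move=> A; exact: is_linf_unique ord (lset_is_linf VV).
- exists (fun x => ⋁_W (VV W ⊗ W x)); split; first exact: lset_is_lsup.
  move=> A; exact: is_lsup_unique ord (lset_is_lsup VV).
Qed.

Definition lset_clord d (L : completeResiduatedLatticeType d) (X : Type) :
    clLOrderedSet L :=
  CLLOrderedSet (@lset_completely_lattice _ L X).

Lemma lset_linfE d (L : completeResiduatedLatticeType d) (X : Type)
  (VV : lset L (lset L X)) :
  @linf _ L (lset_clord L X) VV = (fun x => ⋀_W (VV W ⇒ W x)).
Proof. exact/linf_unique/lset_is_linf. Qed.

(* The infimum is the one of the L-ordered set of all L-sets in X, given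
   pointwise by [lset_linfE]. *)
Definition lclosure_system d (L : completeResiduatedLatticeType d) (X : Type)
    (M : set (lset L X)) :=
  forall VV : lset L (lset L X),
    (forall W, ~ M W -> VV W = \bot) -> M (@linf _ L (lset_clord L X) VV).

Definition comp_rel_set d (L : completeResiduatedLatticeType d) (X : Type)
  (R : lrel L X) (B : lset L X) : lset L X := fun x => ⋁_y (R (x, y) ⊗ B y).

Definition comp_set_rel d (L : completeResiduatedLatticeType d) (X : Type)
  (A : lset L X) (R : lrel L X) : lset L X := fun y => ⋁_x (A x ⊗ R (x, y)).

Definition power_rel d (L : completeResiduatedLatticeType d) (X : Type)
    (R : lrel L X) : lrel L (lset L X) :=
  fun AB => subsethood (AB.1, comp_rel_set R AB.2)
            `&` subsethood (AB.2, comp_set_rel AB.1 R).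

Definition complete_lrel d (L : completeResiduatedLatticeType d)
    (U : clLOrderedSet L) (R : lrel L U) :=
  [/\ lcompatible (@cl_eq _ _ U) R,
      forall V1 V2 : lset L U, power_rel R (V1, V2) <= R (linf V1, linf V2)
    & forall V1 V2 : lset L U, power_rel R (V1, V2) <= R (lsup V1, lsup V2)].

Definition ltolerance d (L : completeResiduatedLatticeType d) (X : Type)
  (R : lrel L X) := lreflexive R /\ lsymmetric R.

Definition CTol d (L : completeResiduatedLatticeType d)
    (U : clLOrderedSet L) : set (lset L (U * U)) :=
  [set R | ltolerance R /\ complete_lrel R]%classic.

Arguments CTol {d L} U.

Definition lrestrict d (L : completeResiduatedLatticeType d) (X : Type)
    (M : set X) (R : lrel L X) : lrel L (set_type M) :=
  fun p => R (val p.1, val p.2).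
Arguments lrestrict {d L X} M R _.

(* Main.v *)
Require Import Defs.
From HB Require Import structures.
From mathcomp Require Import all_boot all_order.
From mathcomp Require Import mathcomp_extra boolp classical_sets.
Set Implicit Arguments.
Unset Strict Implicit.
Unset Printing Implicit Defensive.
Import Order.TTheory.
Local Open Scope order_scope.

(** Let [R] be the graded intersection of complete tolerances [W], each taken
with weight [c = VV W]. Then [c ⊗ R(x, y) <= W(x, y)], and since [R] occurs
positively in the power relation and [⊗] distributes over joins, also
[c ⊗ R^+(V1, V2) <= W^+(V1, V2)]. So every completeness inequality passes from
the [W]'s to [R] by adjointness. For the second part, infima in a closure
system are inherited from the ambient L-ordered set, and a supremum is the
infimum of the upper cone. *)

Section ResiduatedLattice.
Context {d : Order.disp_t} {L : completeResiduatedLatticeType d}.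

Lemma otimes0l (a : L) : \bot ⊗ a = \bot.
Proof. by apply/eqP; rewrite -lex0 adjointness le0x. Qed.

(** Adjointness moves [c] across the inequality, so the join can be bounded term by term. *)
Lemma otimes_bigjoin_le (I : Type) (c : L) (F G : I -> L) :
  (forall i, c ⊗ F i <= G i) -> c ⊗ bigjoin F <= bigjoin G.
Proof.
move=> cFG; rewrite otimesC adjointness; apply: bigjoin_lub => i.
rewrite -adjointness otimesC; apply: le_trans (cFG i) _.
exact: (bigjoin_ub G).
Qed.

Lemma subsethood_weight (X : Type) (c : L) (A B B' : lset L X) :
  (forall x, c ⊗ B x <= B' x) -> c ⊗ subsethood (A, B) <= subsethood (A, B').
Proof.
move=> cB; apply/le_subsethood => x; rewrite -otimesA.
apply: le_trans (cB x); apply: otimes_le2 => //.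
exact: subsethood_le.
Qed.

(** In both inclusions [R] occurs only on the right-hand side, under a join, so the weight [c] can
    be pushed inwards until it meets [R]. *)
Lemma power_rel_weight (X : Type) (c : L) (R R' : lrel L X) V1 V2 :
  (forall p, c ⊗ R p <= R' p) ->
  c ⊗ power_rel R (V1, V2) <= power_rel R' (V1, V2).
Proof.
move=> cR; rewrite /power_rel /= lexI; apply/andP; split.
  apply: le_trans (otimes_le2 (lexx c) (leIl _ _)) _.
  apply: subsethood_weight => x; apply: otimes_bigjoin_le => y.
  by rewrite otimesA otimes_le2.
apply: le_trans (otimes_le2 (lexx c) (leIr _ _)) _.
apply: subsethood_weight => y; apply: otimes_bigjoin_le => x.
by rewrite otimesA [c ⊗ _]otimesC -otimesA otimes_le2.
Qed.

(** Weight [\bot] makes the residuum [\top], so only the members of [M] constrain the meet. *)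
Lemma le_bigmeet_res (X : Type) (M : set (lset L X)) (VV : lset L (lset L X))
    (a : L) (x : X) :
  (forall W, ~ M W -> VV W = \bot) ->
  (forall W, M W -> VV W ⊗ a <= W x) -> a <= ⋀_W (VV W ⇒ W x).
Proof.
move=> VV0 aW; apply: bigmeet_glb => W; rewrite -adjointness otimesC.
have [/aW//|/VV0 ->] := pselect (M W).
by rewrite otimes0l le0x.
Qed.

End ResiduatedLattice.

Lemma CTol_closure_system d (L : completeResiduatedLatticeType d)
  (U : clLOrderedSet L) : lclosure_system (CTol U).
Proof.
move=> VV VV0; rewrite lset_linfE; set R := (fun x => _).
have RW W p : VV W ⊗ R p <= W p.
  by rewrite otimesC adjointness; exact: (bigmeet_lb (fun W => VV W ⇒ W p)).
split; [split|split].
- move=> x; apply/eqP; rewrite -le1x.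
  by apply: (le_bigmeet_res VV0) => W [[-> _] _]; rewrite lex1.
- move=> x y; apply/le_anti/andP.
  by split; apply: (le_bigmeet_res VV0) => W [[_ ->] _]; exact: RW.
- move=> u v u' v'; apply: (le_bigmeet_res VV0) => W [_ [Wc _ _]].
  (* Reassociating joins the weight [VV W] to [R (u, v)], where [RW] applies. *)
  apply: le_trans (Wc u v u' v'); rewrite !otimesA.
  by do 2![apply: otimes_le2 => //].
- move=> V1 V2; apply: (le_bigmeet_res VV0) => W [_ [_ Winf _]].
  exact: le_trans (power_rel_weight _ _ (RW W)) (Winf V1 V2).
- move=> V1 V2; apply: (le_bigmeet_res VV0) => W [_ [_ _ Wsup]].
  exact: le_trans (power_rel_weight _ _ (RW W)) (Wsup V1 V2).
Qed.

(** Every [V v] is at most the degree to which [v] is a lower bound of the upper cone, and such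
    lower bounds lie below [u]. *)
Lemma is_linf_upper_cone d (L : completeResiduatedLatticeType d) (U : Type)
    (leU : lrel L U) (V : lset L U) u :
  is_linf leU (upper_cone leU V) u -> is_lsup leU V u.
Proof.
move=> [lu uu]; split=> //; apply/bigmeet_top => v; apply/res_top.
move/bigmeet_top : uu => /(_ v)/res_top; apply: le_trans.
apply: bigmeet_glb => w; rewrite -adjointness otimesC adjointness.
exact: (bigmeet_lb (fun v => V v ⇒ leU (v, w))).
Qed.

Lemma lrestrict_lordered d (L : completeResiduatedLatticeType d) (U : Type)
    (eqU leU : lrel L U) (M : set U) :
  lordered eqU leU -> lordered (lrestrict M eqU) (lrestrict M leU).
Proof.
move=> [[er es et sep] lr lt lc la].
split; [split|move=> u|move=> u v w|move=> u v u' v'|move=> u v].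
- by move=> u; exact: er.
- by move=> u v; exact: es.
- by move=> u v w; exact: et.
- by move=> u v /sep/val_inj.
- exact: lr.
- exact: lt.
- exact: lc.
- exact: la.
Qed.

Lemma lrestrict_completely_lattice d (L : completeResiduatedLatticeType d)
    (U : clLOrderedSet L) (M : set U) :
  (forall V : lset L U, (forall u, ~ M u -> V u = \bot) -> M (linf V)) ->
  completely_lattice_lordered
    (lrestrict M (@cl_eq _ _ U)) (lrestrict M (@cl_le _ _ U)).
Proof.
move=> Minf; have [Uord _ _] := cl_ax U.
have ord := lrestrict_lordered M Uord.
have inf_ex (V : lset L (set_type M)) :
    exists m, is_linf (lrestrict M (@cl_le _ _ U)) V m.
  (* [E] extends [V] by \bot outside [M]. *)
  pose E : lset L U := fun u => ⋁_w (V (sval (w : {w | val w = u}))).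
  have VE w : V w <= E (val w).
    exact: (bigjoin_ub _ (exist (fun w' => val w' = val w) w erefl)).
  have Mi : M (linf E).
    (* Over a point outside [M] the fibre indexing the join is empty. *)
    apply: Minf => u Mu; apply/eqP; rewrite -lex0; apply: bigjoin_lub.
    by move=> [w wu]; case: Mu; rewrite -wu; exact: set_valP.
  have [lE uE] := linfP E.
  exists (SigSub (mem_set Mi)); split.
    apply/bigmeet_top => w; apply/res_top; apply: le_trans (VE w) _.
    by move/bigmeet_top : lE => /(_ (val w))/res_top.
  apply/bigmeet_top => w; apply/res_top.
  move/bigmeet_top : uE => /(_ (val w))/res_top; apply: le_trans.
  (* For points of [M], the lower cone of [V] is below that of [E], since [E] adds no new
     constraint. *)
  apply: bigmeet_glb => u; rewrite -adjointness otimesC adjointness.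
  apply: bigjoin_lub => -[w' /= <-]; rewrite -adjointness otimesC adjointness.
  exact: (bigmeet_lb (fun u => V u ⇒ cl_le (val w, val u))).
split=> // V.
  have [m mV] := inf_ex V; exists m; split=> // m'.
  exact: is_linf_unique ord mV.
have [m mUV] := inf_ex (upper_cone (lrestrict M (@cl_le _ _ U)) V).
have mV := is_linf_upper_cone mUV.
by exists m; split=> // m'; exact: is_lsup_unique ord mV.
Qed.

Theorem theorem10 (d : Order.disp_t) (L : completeResiduatedLatticeType d)
    (U : clLOrderedSet L) :
  lclosure_system (CTol U) /\
  completely_lattice_lordered
    (lrestrict (CTol U) (@lset_eq d L (U * U)))
    (lrestrict (CTol U) (@subsethood d L (U * U))).
Proof.
split; first exact: CTol_closure_system.
(* With all L-sets in [U * U] as the ambient ordered set, closure under infima is exactly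
   [lclosure_system]. *)
exact: (@lrestrict_completely_lattice _ _ (lset_clord L (U * U)) _
  (@CTol_closure_system _ _ U)).
Qed.
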